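(* Let $d\in\mathbb N$ and let $A$ be a real $d\times d$ diagonalizable matrix with positive eigenvalues. Assume that all eigenvectors of $A$ belong to $V=\mathbb R^d_*=(\mathbb R\setminus\{0\})^d$. A function of type (M) with multi-indices $\nu,\gamma$ is a function $$x\in\mathbb R^d\mapsto\|x\|_p^\nu\,\langle x\rangle_\tau^\gamma\,c,$$ where $m\in\mathbb N$, $p\in[1,\infty)^m$, $\nu=(\nu_1,\dots,\nu_m)\in[0,\infty)^m$, $\gamma=(\gamma_1,\dots,\gamma_d)$ and $\tau=(\tau_1,\dots,\tau_d)$ satisfy $(\gamma_j,\tau_j)\in\omega$ for $1\le j\le d$, and $c\in\mathbb R^d$ is a constant vector (the set $\omega$ and the power notation are defined in the context). (i) Suppose $F:\mathbb R^d\to\mathbb R^d$ and $\beta\in(1,\infty)$ are such that $F$ is a finite sum of functions of type (M), each with $|\nu|+|\gamma|=\beta$. Then $$F(0)=0\quad\text{and}\quad F\in\mathcal H_\beta(\mathbb R^d)\cap C(\mathbb R^d)\cap C^\infty(V).$$ Consequently, $F$ belongs to $\mathcal X^0(V)$, and $F$ can also play the role of a function $F_k$, with $\beta_k=\beta$, in an approximation of type (E1) or (E3) (defined in the context). (ii) Suppose $F$ is a finite sum of functions of type (M) with multi-indices $\nu=(\nu_1,\dots,\nu_m)$ and $\gamma=(\gamma_1,\dots,\gamma_d)$ each satisfying (a) $|\nu|+|\gamma|>1$, and (b) $|\nu|=0$ or ($\nu_i\ge1$ for all $i=1,\dots,m$), and (c) for all $j=1,\dots,d$: $\gamma_j=0$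 or $\gamma_j\ge1$. Then $F\in\mathcal X(V)$.
   Context: $\mathbb Z_+=\{0,1,2,\dots\}$. For a multi-index, $|\nu|=\nu_1+\dots+\nu_m$, $|\gamma|=\gamma_1+\dots+\gamma_d$; for a vector $x$, $|x|$ is the Euclidean norm. $\|x\|_q=(\sum_{j=1}^d|x_j|^q)^{1/q}$ is the $\ell^q$-norm, $q\ge1$. The parameters $m,p,\nu,\gamma,\tau,c$ may vary from one summand to another. Power notation. $\omega=(\mathbb Z_+\times\{0\})\cup([0,\infty)\times\{-1,1\})\subset\mathbb R^2$. For $x\in\mathbb R$ and $(\gamma,\tau)\in\omega$: $\langle x\rangle_0^0=\langle x\rangle_1^0=\langle x\rangle_{-1}^0=1$, and for $\gamma>0$, $\langle x\rangle_0^\gamma=x^\gamma$, $\langle x\rangle_1^\gamma=|x|^\gamma$, $\langle x\rangle_{-1}^\gamma=|x|^\gamma\,\mathrm{sign}(x)$. For $x\in\mathbb R^d$ and $\gamma,\tau$ with $(\gamma_j,\tau_j)\in\omega$ for all $j$: $\langle x\rangle_\tau^\gamma=\langle x_1\rangle_{\tau_1}^{\gamma_1}\cdots\langle x_d\rangle_{\tau_d}^{\gamma_d}$. For $p\in[1,\infty)^m$, $\nu\in[0,\infty)^m$: $\|x\|_p^\nu=\|x\|_{p_1}^{\nu_1}\cdots\|x\|_{p_m}^{\nu_m}$ with the convention $\|x\|_{p_i}^0=1$. $\mathcal H_\beta(\mathbb R^d)$ is the set of functions $G:\mathbb R^d\to\mathbb R^d$ with $G(tx)=t^\beta G(x)$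 for all $x\in\mathbb R^d$, $t>0$. ''$G\in C^\infty(V)$'' means that $G$ restricted to $V$ is infinitely differentiable. ''$f(x)=\mathcal O(h(x))$ as $x\to0$'' means there are $r,C>0$ with $|f(x)|\le Ch(x)$ for all $|x|<r$. Approximations of a function $H:\mathbb R^d\to\mathbb R^d$, where every $F_k\in\mathcal H_{\beta_k}(\mathbb R^d)\cap C^\infty(V)$ and $\beta_k\in(1,\infty)$: (E1) $\beta_k$, $k\in\mathbb N$, strictly increase to infinity and for every $N\in\mathbb N$, $|H(x)-\sum_{k=1}^NF_k(x)|=\mathcal O(|x|^{\beta'})$ as $x\to0$ for some $\beta'>\beta_N$; (E2) for some $N_*\in\mathbb N$, $\beta_1<\dots<\beta_{N_*}$ and $|H(x)-\sum_{k=1}^{N_*}F_k(x)|=\mathcal O(|x|^{\beta'})$ as $x\to0$ for all $\beta'>\beta_{N_*}$; (E3) for some $N_*\in\mathbb N$ and $\bar\varepsilon>0$, $\beta_1<\dots<\beta_{N_*}$ and $|H(x)-\sum_{k=1}^{N_*}F_k(x)|=\mathcal O(|x|^{\beta_{N_*}+\bar\varepsilon})$ as $x\to0$. A function ''can play the role of $F_k$ with $\beta_k=\beta$'' in (E1) or (E3) if it meets the requirement imposed there on $F_k$, i.e. it lies in $\mathcal H_\beta(\mathbb R^d)\cap C^\infty(V)$ with $\beta>1$. $\mathcal X(V)$ (respectively $\mathcal X^0(V)$) is the set of locally Lipschitz (respectively continuous) functions $\mathbb R^d\to\mathbb R^d$ having an approximation of type (E1) or (E2). *)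

(* Defs.v *)
From HB Require Import structures.
From mathcomp Require Import all_boot all_order all_algebra.
From mathcomp Require Export all_classical all_reals all_analysis.

Set Implicit Arguments.
Unset Strict Implicit.
Unset Printing Implicit Defensive.

Import Order.TTheory GRing.Theory Num.Theory.
Import numFieldNormedType.Exports.

Local Open Scope classical_set_scope.
Local Open Scope ring_scope.

(* Points of R^d are column vectors.  The norm that MathComp-Analysis attaches
   to matrices is the maximum norm; it is used below only through notions that
   are the same for all norms on R^d (continuity, Frechet differentiability,
   local Lipschitz continuity).  Everywhere else the norms are explicit. *)

Section PowerNotation.
Context {R : realType} {d : nat}.
Implicit Type x : 'cV[R]_d.

Definition enorm x : R := Num.sqrt (\sum_(j < d) x j 0 ^+ 2).

Definition lqnorm (q : R) x : R :=
  (\sum_(j < d) `|x j 0| `^ q) `^ q^-1.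

(* Pairs are (gamma, tau). *)
Definition omega : set (R * R) :=
  (range (fun n : nat => n%:R) `*` [set 0]) `|`
  ([set g | 0 <= g] `*` [set -1; 1]).

(* When tau = 0 and (gamma, tau) is in omega, gamma is a natural number and
   Num.truncn gamma is that number. *)
Definition spow (tau gamma t : R) : R :=
  if gamma == 0 then 1
  else if tau == 0 then t ^+ Num.truncn gamma
  else if tau == 1 then `|t| `^ gamma
  else `|t| `^ gamma * Num.sg t.

Definition spowv (tau gamma : 'I_d -> R) x : R :=
  \prod_(j < d) spow (tau j) (gamma j) (x j 0).

(* The convention that a norm to the power 0 is 1, even at x = 0, is built
   into powR: powRr0 states a `^ 0 = 1 for all a. *)
Definition normpow (m : nat) (p nu : 'I_m -> R) x : R :=
  \prod_(i < m) lqnorm (p i) x `^ nu i.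

End PowerNotation.

Record typeM (R : realType) (d : nat) := TypeM {
  tm : nat;
  tp : 'I_tm -> R;
  tnu : 'I_tm -> R;
  tgamma : 'I_d -> R;
  ttau : 'I_d -> R;
  tc : 'cV[R]_d;
  tm_gt0 : (0 < tm)%N;
  tp_ge1 : forall i, 1 <= tp i;
  tnu_ge0 : forall i, 0 <= tnu i;
  t_omega : forall j, omega (tgamma j, ttau j)
}.

Arguments tp {R d} t i.
Arguments tnu {R d} t i.
Arguments tgamma {R d} t j.
Arguments ttau {R d} t j.
Arguments tp_ge1 {R d} t i.
Arguments tnu_ge0 {R d} t i.
Arguments t_omega {R d} t j.

Section TypeM.
Context {R : realType} {d : nat}.
Implicit Type T : typeM R d.

Definition typeM_fun T (x : 'cV[R]_d) : 'cV[R]_d :=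
  (normpow (tp T) (tnu T) x * spowv (ttau T) (tgamma T) x) *: tc T.

Definition abs_nu T : R := \sum_(i < tm T) tnu T i.
Definition abs_gamma T : R := \sum_(j < d) tgamma T j.

Definition sum_typeM (P : typeM R d -> Prop) (F : 'cV[R]_d -> 'cV[R]_d) :=
  exists (n : nat) (T : 'I_n -> typeM R d),
    (forall k, P (T k)) /\
    (forall x, F x = \sum_(k < n) typeM_fun (T k) x).

End TypeM.

Section Approximations.
Context {R : realType} {d : nat}.
Implicit Types (V : set 'cV[R]_d) (F G H : 'cV[R]_d -> 'cV[R]_d).

Definition Rstar : set 'cV[R]_d := [set x | forall j, x j 0 != 0].

Definition homogeneous (beta : R) G :=
  forall x (t : R), 0 < t -> G (t *: x) = t `^ beta *: G x.

(* For V open.  In finite dimension, 'd G is differentiable as an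
   operator-valued map iff x |-> 'd G x v is differentiable for every v. *)
Fixpoint ndiff (n : nat) V G : Prop :=
  if n is n'.+1 then
    (forall x, V x -> differentiable G x) /\
    (forall v, ndiff n' V (fun x => 'd G x v))
  else True.

Definition smooth V G := forall n, ndiff n V G.

Definition locally_lipschitz G :=
  forall x : 'cV[R]_d, exists2 U, nbhs x U & [lipschitz G y | y in U].

(* |G x| = O(h x) as x -> 0, the point x = 0 included. *)
Definition bigO0 G (h : 'cV[R]_d -> R) :=
  exists r C : R, [/\ 0 < r, 0 < C &
    forall x, enorm x < r -> enorm (G x) <= C * h x].

(* The requirement on the pair (F_k, beta_k) in (E1), (E2) and (E3); this is
   what "F can play the role of F_k with beta_k = beta" means. *)
Definition can_play_role V (beta : R) F :=
  [/\ 1 < beta, homogeneous beta F & smooth V F].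

(* In (E1)-(E3) indices start at 0: beta k and F k stand for beta_(k+1) and
   F_(k+1), and the partial sum compared with beta N is the one up to and
   including F N. *)
Definition remainder H (F : nat -> 'cV[R]_d -> 'cV[R]_d) (N : nat) x :=
  H x - \sum_(k < N.+1) F k x.

Definition E1 V H :=
  exists (beta : nat -> R) (F : nat -> 'cV[R]_d -> 'cV[R]_d),
    [/\ forall k, can_play_role V (beta k) (F k),
        forall k l, (k < l)%N -> beta k < beta l,
        beta @ \oo --> +oo &
        forall N, exists beta' : R, beta N < beta' /\
          bigO0 (remainder H F N) (fun x => enorm x `^ beta')].

Definition E2 V H :=
  exists (N : nat) (beta : nat -> R) (F : nat -> 'cV[R]_d -> 'cV[R]_d),
    [/\ forall k, (k <= N)%N -> can_play_role V (beta k) (F k),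
        forall k l, (k < l <= N)%N -> beta k < beta l &
        forall beta' : R, beta N < beta' ->
          bigO0 (remainder H F N) (fun x => enorm x `^ beta')].

Definition E3 V H :=
  exists (N : nat) (beta : nat -> R) (F : nat -> 'cV[R]_d -> 'cV[R]_d)
         (eps : R),
    [/\ 0 < eps,
        forall k, (k <= N)%N -> can_play_role V (beta k) (F k),
        forall k l, (k < l <= N)%N -> beta k < beta l &
        bigO0 (remainder H F N) (fun x => enorm x `^ (beta N + eps))].

Definition classX V : set ('cV[R]_d -> 'cV[R]_d) :=
  [set H | locally_lipschitz H /\ (E1 V H \/ E2 V H)].

Definition classX0 V : set ('cV[R]_d -> 'cV[R]_d) :=
  [set H | continuous H /\ (E1 V H \/ E2 V H)].

Definition eigenvector (A : 'M[R]_d) (v : 'cV[R]_d) :=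
  v != 0 /\ exists a : R, A *m v = a *: v.

End Approximations.

(* Main.v *)
Require Import Defs.
From HB Require Import structures.
From mathcomp Require Import all_boot all_order all_algebra.
From mathcomp Require Import all_classical all_reals all_analysis.
From mathcomp Require Import ring lra.

Set Implicit Arguments.
Unset Strict Implicit.
Unset Printing Implicit Defensive.

Import Order.TTheory GRing.Theory Num.Theory.
Import numFieldNormedType.Exports.

Local Open Scope classical_set_scope.
Local Open Scope ring_scope.

(** Everything reduces to three facts about the scalar factor of a function of
    type (M), a product of powers of the norms and of the coordinates.

    Homogeneity.  Each norm is homogeneous of degree 1 and each coordinate
    power of degree gamma_j, so the factor has degree |nu| + |gamma|
    ([typeM_homogeneous]).  As this degree is positive, F (2 *: 0) = F 0
    forces F 0 = 0.

    Smoothness on the open set where no coordinate vanishes.  There, the signs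
    of the coordinates are locally constant, their absolute values are locally
    linear, and the sums of powers inside the norms are positive.  The
    functions generated from constants, coordinates, absolute values and signs
    of coordinates by sums, products and real powers of positive functions
    therefore form a class stable under directional derivatives
    ([powalg_diff]).  A class of differentiable functions that is stable in
    this way consists of smooth functions ([ndiff_powalg]), and it contains the
    factor in question ([powalg_typeM]).

    Continuity and local Lipschitz continuity on the whole space.  Minkowski's
    inequality ([lqnormD]) makes the norms Lipschitz.  The map sending t to the
    power p of |t| is continuous for p >= 0 and locally Lipschitz for p >= 1 by
    convexity ([powR_lip]); a signed power is the difference of the powers of
    the positive and negative parts ([signed_powRE]).  Both properties pass to
    compositions, products and sums ([typeM_continuous], [typeM_loclip]).

    The expansion is exact: grouping the summands by degree and listing the
    degrees increasingly writes F as a finite sum of homogeneous smooth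
    functions, so the remainder in (E2) is zero ([E2_sum_typeM]). *)

(** * Differentials and convexity *)

Lemma near_eq_is_diff (R : numFieldType) (V W : normedModType R)
    (f g df : V -> W) (x : V) :
  (\near x, f x = g x) -> is_diff x f df -> is_diff x g df.
Proof.
move=> fg [fx <-]; have fgx := nbhs_singleton fg.
have gE : g \o shift x = cst (g x) + 'd f x +o_ 0 id.
  have /eqaddoP fE := diff_locally fx.
  apply/eqaddoP => e /fE; apply: filter_app.
  have := fg; rewrite (near_shift 0 x) subr0; apply: filterS => y /= fgy.
  by rewrite !fctE /= fgx -fgy.
have dg : 'd g x = 'd f x :> (V -> W).
  by apply: diff_unique => //; exact: diff_continuous.
split=> //; apply/diff_locallyP; rewrite dg; split=> //.
exact: diff_continuous.
Qed.

Lemma powR_convex (R : realType) (p t x y : R) : 1 <= p -> 0 <= t <= 1 ->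
  0 <= x -> 0 <= y ->
  (t * x + (1 - t) * y) `^ p <= t * x `^ p + (1 - t) * y `^ p.
Proof.
move=> p1 /andP[t0 t1] x0 y0.
by apply: (convex_powR p1 (Itv01 t0 t1)); rewrite inE/= in_itv/= andbT.
Qed.

(** The slope of a convex function over [b, a] is at most its slope over
    [a, a + 1], and the latter is at most its value at a + 1. *)
Lemma powR_lip (R : realType) (p a b : R) : 1 <= p -> 0 <= b -> b <= a ->
  a `^ p - b `^ p <= (a + 1) `^ p * (a - b).
Proof.
move=> p1 b0 ba; set l := a - b; have l0 : 0 <= l by rewrite subr_ge0.
have l1 : 0 < l + 1 by lra.
(* a is the barycentre of a + 1 and b with the weights l / (l + 1) and
   1 / (l + 1) *)
have t01 : 0 <= l / (l + 1) <= 1.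
  by rewrite divr_ge0 ?(ltW l1)//= ler_pdivrMr//; lra.
have a0 : 0 <= a + 1 by lra.
have := powR_convex p1 t01 a0 b0.
have -> : l / (l + 1) * (a + 1) + (1 - l / (l + 1)) * b = a.
  by rewrite /l; field; rewrite lt0r_neq0.
rewrite -(ler_pM2l l1); set v := b `^ p; set u := (a + 1) `^ p.
have -> : (l + 1) * (l / (l + 1) * u + (1 - l / (l + 1)) * v) = l * u + v.
  by field; rewrite lt0r_neq0.
have : 0 <= l * a `^ p by rewrite mulr_ge0 ?powR_ge0.
by move: (a `^ p) u v l {t01 l0 l1} => A u v l; lra.
Qed.

(** * Powers of absolute values and l^q norms *)

Lemma le_mx_norm (R : realType) (d : nat) (x : 'cV[R]_d) (j : 'I_d) :
  `|x j 0| <= `|x|.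
Proof.
rewrite [leRHS]/Num.norm /= mx_normrE.
exact: (@le_bigmax _ _ _ _ (fun ij : 'I_d * 'I_1 => `|x ij.1 ij.2|) (j, 0)).
Qed.

(** Taking the absolute value first matters: powR is the constant 1 on negative
    numbers, so the bare power jumps at 0. *)
Lemma abs_powR_continuous (R : realType) (g : R) : 0 <= g ->
  continuous (fun t : R => `|t| `^ g).
Proof.
rewrite le_eqVlt => /predU1P[<-|g0].
  have -> : (fun t : R => `|t| `^ 0) = cst 1.
    by apply/funext => t; rewrite powRr0.
  exact: cst_continuous.
move=> t; have [->|t0] := eqVneq t 0; last first.
  apply: (@continuous_comp _ _ _ (Num.norm : R -> R) (fun s : R => s `^ g)).
    exact: norm_continuous.
  apply: differentiable_continuous; apply/derivable1_diffP.
  by apply: derivable_powR; rewrite in_itv/= andbT normr_gt0.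
apply/cvgrPdist_le => e e0; rewrite normr0 powR0 ?gt_eqF//.
have r0 : 0 < e `^ g^-1 by rewrite powR_gt0.
have eE : e = (e `^ g^-1) `^ g.
  by rewrite -powRrM mulVf ?gt_eqF// powRr1// ltW.
have nr : \forall s \near (0 : R), `|s| <= e `^ g^-1 := nbhs0_le r0.
near=> s.
have sr : `|s| <= e `^ g^-1 by near: s; exact: nr.
rewrite sub0r normrN ger0_norm ?powR_ge0// eE.
by rewrite ge0_ler_powR ?nnegrE ?powR_ge0 ?(ltW g0).
Unshelve. all: by end_near. Qed.

Lemma abs_powR_lip (R : realType) (p s t : R) : 1 <= p ->
  `| `|s| `^ p - `|t| `^ p | <= (`|s| + `|t| + 1) `^ p * `|s - t|.
Proof.
move=> p1; wlog st : s t / `|t| <= `|s|.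
  move=> H; have [/H//|/ltW/H] := leP `|t| `|s|.
  by rewrite distrC [`|t - s|]distrC [`|t| + _]addrC.
have p0 : 0 <= p by lra.
rewrite ger0_norm; last by rewrite subr_ge0 ge0_ler_powR ?nnegrE.
apply: le_trans (powR_lip p1 (normr_ge0 _) st) _.
apply: ler_pM; rewrite ?powR_ge0 ?subr_ge0//; last exact: lerB_dist.
by apply: ge0_ler_powR; rewrite ?nnegrE ?addr_ge0// lerD2r lerDl.
Qed.

Section Lqnorm.
Context {R : realType} {d : nat}.
Implicit Types (x y : 'cV[R]_d) (q : R).

Lemma lqnorm_ge0 q x : 0 <= lqnorm q x.
Proof. exact: powR_ge0. Qed.

Lemma powR_lqnorm q x : 1 <= q -> lqnorm q x `^ q = \sum_(j < d) `|x j 0| `^ q.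
Proof.
move=> q1; rewrite -powRrM mulVf ?powRr1 ?sumr_ge0//.
by rewrite gt_eqF//; lra.
Qed.

Lemma lqnorm_le q x c : 1 <= q -> 0 <= c ->
  \sum_(j < d) `|x j 0| `^ q <= c `^ q -> lqnorm q x <= c.
Proof.
move=> q1 c0; have q0 : 0 < q by lra.
rewrite -powR_lqnorm// leNgt => h; rewrite leNgt; apply: contra h => h.
by apply: gt0_ltr_powR; rewrite ?nnegrE ?lqnorm_ge0.
Qed.

Lemma lqnormZ q t x : 1 <= q -> 0 < t -> lqnorm q (t *: x) = t * lqnorm q x.
Proof.
move=> q1 t0; rewrite /lqnorm.
under eq_bigr do rewrite mxE normrM powRM// gtr0_norm//.
rewrite -mulr_sumr powRM ?powR_ge0 ?sumr_ge0//.
by rewrite -powRrM mulfV ?powRr1 ?(ltW t0)// gt_eqF//; lra.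
Qed.

Lemma lqnorm0_eq0 q x : 1 <= q -> lqnorm q x = 0 -> x = 0.
Proof.
move=> q1 x0; have q0 : q != 0 by rewrite gt_eqF//; lra.
have /eqP := powR_lqnorm x q1; rewrite x0 powR0// eq_sym psumr_eq0//.
move=> /allP x0j; apply/colP => j; rewrite mxE.
have := x0j j (mem_index_enum _); rewrite /= => /eqP/powR_eq0_eq0/eqP.
by rewrite normr_eq0 => /eqP.
Qed.

(** Minkowski's inequality.  With a and b the norms of x and y, the vector
    (x + y) / (a + b) is a convex combination of the unit vectors x / a and
    y / b, and the q-th power of the norm is convex. *)
Lemma lqnormD q x y : 1 <= q -> lqnorm q (x + y) <= lqnorm q x + lqnorm q y.
Proof.
move=> q1; have q0 : 0 <= q by lra.
have [/(lqnorm0_eq0 q1) ->|x0] := eqVneq (lqnorm q x) 0.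
  by rewrite add0r lerDr lqnorm_ge0.
have [/(lqnorm0_eq0 q1) ->|y0] := eqVneq (lqnorm q y) 0.
  by rewrite addr0 lerDl lqnorm_ge0.
have := powR_lqnorm x q1; have := powR_lqnorm y q1.
have {x0} : 0 < lqnorm q x by rewrite lt_neqAle eq_sym x0 lqnorm_ge0.
have {y0} : 0 < lqnorm q y by rewrite lt_neqAle eq_sym y0 lqnorm_ge0.
have := @lqnorm_le q (x + y) _ q1.
move: (lqnorm q x) (lqnorm q y) => a b le b0 a0 bE aE.
have ab0 : 0 < a + b by lra.
apply: le; first exact: ltW.
pose t := a / (a + b).
have t01 : 0 <= t <= 1 by rewrite divr_ge0/= ?ler_pdivrMr//; lra.
have u : 1 - t = b / (a + b) by rewrite /t; field; rewrite gt_eqF.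
apply: (@le_trans _ _ (\sum_(j < d) (a + b) `^ q *
    (t * (`|x j 0| / a) `^ q + (1 - t) * (`|y j 0| / b) `^ q))).
  apply: ler_sum => j _; rewrite mxE.
  apply: (@le_trans _ _ ((`|x j 0| + `|y j 0|) `^ q)).
    by rewrite ge0_ler_powR ?nnegrE ?addr_ge0// ler_normD.
  have -> : `|x j 0| + `|y j 0| =
      (a + b) * (t * (`|x j 0| / a) + (1 - t) * (`|y j 0| / b)).
    by rewrite u /t; field; rewrite !gt_eqF.
  have xa : 0 <= `|x j 0| / a by exact: divr_ge0 (normr_ge0 _) (ltW a0).
  have yb : 0 <= `|y j 0| / b by exact: divr_ge0 (normr_ge0 _) (ltW b0).
  case/andP: (t01) => t0 t1.
  rewrite powRM ?(ltW ab0)//; last first.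
    by apply: addr_ge0; apply: mulr_ge0; rewrite ?subr_ge0.
  by apply: ler_wpM2l; [exact: powR_ge0|exact: powR_convex].
(* a nonzero vector divided by its norm has norm 1 *)
have div (z : 'cV[R]_d) c : 0 < c -> c `^ q = \sum_(j < d) `|z j 0| `^ q ->
    \sum_(j < d) (`|z j 0| / c) `^ q = 1 :> R.
  move=> c0 cE; under eq_bigr do rewrite powRM ?invr_ge0 ?(ltW c0)//.
  rewrite -mulr_suml -cE -powRM ?invr_ge0 ?(ltW c0)// divff ?gt_eqF//.
  by rewrite powR1.
rewrite -mulr_sumr big_split -!mulr_sumr (div x a)// (div y b)//=.
by rewrite !mulr1 addrC subrK mulr1.
Qed.

Lemma lqnorm_lip q x y : 1 <= q ->
  `|lqnorm q x - lqnorm q y| <= d%:R `^ q^-1 * `|x - y|.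
Proof.
move=> q1; have q0 : 0 <= q by lra.
wlog xy : x y / lqnorm q y <= lqnorm q x.
  move=> H; have [/H//|/ltW/H yx] := leP (lqnorm q y) (lqnorm q x).
  by rewrite (distrC (lqnorm q x)) (distrC x).
rewrite ger0_norm ?subr_ge0// lerBlDr -{1}(subrK y x).
apply: le_trans (lqnormD _ _ q1) _; rewrite lerD2r.
apply: lqnorm_le => //.
have dq : (d%:R `^ q^-1) `^ q = d%:R :> R.
  by rewrite -powRrM mulVf ?powRr1// gt_eqF// (lt_le_trans ltr01).
rewrite powRM ?powR_ge0// dq.
apply: (@le_trans _ _ (\sum_(j < d) `|x - y| `^ q)).
  apply: ler_sum => j _; apply: ge0_ler_powR; rewrite ?nnegrE ?le_mx_norm//.
by rewrite sumr_const card_ord mulr_natl.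
Qed.

End Lqnorm.

(** * Locally Lipschitz maps *)

Definition loclip (R : realType) (V W : normedModType R) (f : V -> W) :=
  forall x : V, exists2 U, nbhs x U &
    exists K : R, forall y z, U y -> U z -> `|f y - f z| <= K * `|y - z|.

Section Loclip.
Context {R : realType}.

Lemma loclip_lip (V W : normedModType R) (f : V -> W) (K : R) :
  (forall y z, `|f y - f z| <= K * `|y - z|) -> loclip f.
Proof. by move=> fK x; exists setT; [exact: filterT|exists K]. Qed.

(** Chaining two Lipschitz estimates multiplies an inequality by the constant,
    which must then be nonnegative. *)
Lemma loclip_ge0 (V W : normedModType R) (f : V -> W) (x : V) : loclip f ->
  exists2 U, nbhs x U &
    exists2 K, 0 <= K & forall y z, U y -> U z -> `|f y - f z| <= K * `|y - z|.
Proof.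
move=> /(_ x)[U xU [K fK]]; exists U => //; exists `|K| => // y z Uy Uz.
by apply: le_trans (fK _ _ Uy Uz) _; rewrite ler_wpM2r// ler_norm.
Qed.

Lemma loclip_continuous (V W : normedModType R) (f : V -> W) :
  loclip f -> continuous f.
Proof.
move=> lf x; have [U xU [K K0 fK]] := loclip_ge0 x lf.
have Ux := nbhs_singleton xU.
apply/cvgrPdist_le => e e0; have K1 : 0 < K + 1 by lra.
near=> y.
have Uy : U y by near: y.
have xy : `|x - y| <= e / (K + 1).
  by near: y; apply: cvgr_dist_le; rewrite ?divr_gt0//; exact: cvg_id.
apply: le_trans (fK _ _ Ux Uy) _.
apply: (@le_trans _ _ ((K + 1) * `|x - y|)); first by rewrite ler_wpM2r// lerDl.
by rewrite -ler_pdivlMl// mulrC.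
Unshelve. all: by end_near. Qed.

Lemma loclip_comp (V W Z : normedModType R) (f : V -> W) (g : W -> Z) :
  loclip f -> loclip g -> loclip (g \o f).
Proof.
move=> lf lg x; have [U xU [K fK]] := lf x.
have [U' xU' [K' K'0 gK]] := loclip_ge0 (f x) lg.
exists (U `&` f @^-1` U').
  by apply: filterI => //; exact: (loclip_continuous lf).
exists (K' * K) => y z [Uy Uy'] [Uz Uz'].
apply: le_trans (gK _ _ Uy' Uz') _.
by rewrite -mulrA ler_wpM2l// fK.
Qed.

Lemma loclip_cst (V W : normedModType R) (c : W) : loclip (fun _ : V => c).
Proof.
by apply: (@loclip_lip _ _ _ 0) => y z; rewrite subrr normr0 mul0r.
Qed.

Lemma loclipD (V W : normedModType R) (f g : V -> W) :
  loclip f -> loclip g -> loclip (fun x => f x + g x).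
Proof.
move=> lf lg x; have [U xU [K fK]] := lf x; have [U' xU' [K' gK]] := lg x.
exists (U `&` U'); first exact: filterI.
exists (K + K') => y z [Uy Uy'] [Uz Uz'].
rewrite opprD addrACA (le_trans (ler_normD _ _))// mulrDl.
by rewrite lerD ?fK ?gK.
Qed.

Lemma loclipZl (V W : normedModType R) (f : V -> R) (c : W) :
  loclip f -> loclip (fun x => f x *: c).
Proof.
move=> lf; apply: (loclip_comp lf (g := fun s : R => s *: c)).
apply: (@loclip_lip _ _ _ `|c|) => y z.
by rewrite -scalerBl normrZ mulrC.
Qed.

Lemma loclipM (V : normedModType R) (f g : V -> R) :
  loclip f -> loclip g -> loclip (fun x => f x * g x).
Proof.
move=> lf lg x.
have [U xU [K K0 fK]] := loclip_ge0 x lf.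
have [U' xU' [K' K'0 gK]] := loclip_ge0 x lg.
have bnd (h : V -> R) : loclip h -> \forall y \near x, `|h y| <= `|h x| + 1.
  move=> /loclip_continuous/(_ x)/cvgrPdist_le/(_ _ ltr01) hx.
  near=> y; rewrite -[h y](subrK (h x)) addrC (le_trans (ler_normD _ _))//.
  by rewrite lerD2l distrC; near: y.
exists ((U `&` U') `&` ([set y | `|f y| <= `|f x| + 1] `&`
    [set y | `|g y| <= `|g x| + 1])).
  by apply: filterI; apply: filterI => //; exact: bnd.
exists ((`|f x| + 1) * K' + (`|g x| + 1) * K).
move=> y z [[Uy Uy'] [/= fy gy]] [[Uz Uz'] [/= fz gz]].
have -> : f y * g y - f z * g z = f y * (g y - g z) + g z * (f y - f z) by ring.
rewrite (le_trans (ler_normD _ _))// !normrM mulrDl -!mulrA.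
by rewrite lerD// ler_pM// ?fK ?gK.
Unshelve. all: by end_near. Qed.

Lemma loclip_sum (V W : normedModType R) (I : Type) (s : seq I)
    (f : I -> V -> W) : (forall i, loclip (f i)) ->
  loclip (fun x => \sum_(i <- s) f i x).
Proof.
move=> lf; elim: s => [|i s IH].
  have -> : (fun x => \sum_(i <- [::]) f i x) = fun=> 0.
    by apply/funext => x; rewrite big_nil.
  exact: loclip_cst.
have -> : (fun x => \sum_(j <- i :: s) f j x) = fun x =>
    f i x + \sum_(j <- s) f j x.
  by apply/funext => x; rewrite big_cons.
exact: loclipD.
Qed.

Lemma loclip_prod (V : normedModType R) (I : Type) (s : seq I)
    (f : I -> V -> R) : (forall i, loclip (f i)) ->
  loclip (fun x => \prod_(i <- s) f i x).
Proof.
move=> lf; elim: s => [|i s IH].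
  have -> : (fun x => \prod_(i <- [::]) f i x) = fun=> 1.
    by apply/funext => x; rewrite big_nil.
  exact: loclip_cst.
have -> : (fun x => \prod_(j <- i :: s) f j x) = fun x =>
    f i x * \prod_(j <- s) f j x.
  by apply/funext => x; rewrite big_cons.
exact: loclipM.
Qed.

Lemma loclip_abs_powR (p : R) : 1 <= p -> loclip (fun t : R => `|t| `^ p).
Proof.
move=> p1 x; exists (ball x 1); first exact: nbhsx_ballx.
exists ((`|x| + 1 + (`|x| + 1) + 1) `^ p) => y z xy xz.
have bnd s : ball x 1 s -> `|s| <= `|x| + 1.
  rewrite -ball_normE /= => xs; rewrite -[s](subrK x) addrC.
  by rewrite (le_trans (ler_normD _ _))// lerD2l distrC ltW.
apply: le_trans (abs_powR_lip _ _ p1) _; rewrite ler_wpM2r//.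
by rewrite ge0_ler_powR ?nnegrE ?addr_ge0// ?lerD ?bnd//; lra.
Qed.

Lemma loclip_coord (d : nat) (j : 'I_d) : loclip (fun x : 'cV[R]_d => x j 0).
Proof.
apply: (@loclip_lip _ _ _ 1) => y z; rewrite mul1r.
by have := le_mx_norm (y - z) j; rewrite !mxE.
Qed.

Lemma loclip_lqnorm (d : nat) (q : R) : 1 <= q ->
  loclip (lqnorm q : 'cV[R]_d -> R).
Proof. by move=> q1; apply: loclip_lip => y z; exact: lqnorm_lip. Qed.

Lemma loclip_posp : loclip (fun t : R => Num.max t 0).
Proof.
apply: (@loclip_lip _ _ _ 1) => y z; rewrite mul1r.
case: (leP y 0) => y0; case: (leP z 0) => z0; rewrite ?subrr ?normr0//.
all: rewrite !ler_norml; have := ler_norm (y - z); have := ler_norm (z - y).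
all: by rewrite (distrC z y) => ? ?; apply/andP; split; lra.
Qed.

Lemma loclip_opp (V : normedModType R) : loclip (fun t : V => - t).
Proof.
by apply: (@loclip_lip _ _ _ 1) => y z; rewrite mul1r -opprD normrN.
Qed.

Lemma loclip_id (V : normedModType R) : loclip (fun t : V => t).
Proof. by apply: (@loclip_lip _ _ _ 1) => y z; rewrite mul1r. Qed.

End Loclip.

(** * Continuity and homogeneity of functions of type (M) *)

Lemma prod_powR (R : realType) (t : R) (I : Type) (s : seq I) (a : I -> R) :
  0 < t -> \prod_(i <- s) t `^ a i = t `^ (\sum_(i <- s) a i).
Proof.
move=> t0; symmetry; apply: (big_morph (powR t)); last exact: powRr0.
by move=> x y; rewrite powRD// (gt_eqF t0) implybT.
Qed.

Section ScalarPower.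
Context {R : realType}.
Implicit Types (tau gamma t : R).

(** A zero exponent is absorbed in the first form, with n = 0, whatever tau is;
    in the other two forms the exponent is positive, so they vanish at 0. *)
Lemma spow_cases tau gamma : omega (gamma, tau) ->
  [\/ exists2 n : nat, gamma = n%:R & spow tau gamma = (fun t => t ^+ n),
      0 < gamma /\ spow tau gamma = (fun t => `|t| `^ gamma) |
      0 < gamma /\ spow tau gamma = (fun t => `|t| `^ gamma * Num.sg t)].
Proof.
have [-> _|g0] := eqVneq gamma 0.
  apply: Or31; exists 0%N => //; apply/funext => t.
  by rewrite /spow eqxx expr0.
case=> -[/=].
  move=> [n _ gn] ->; apply: Or31; exists n; first by [].
  by apply/funext => t; rewrite /spow (negPf g0) eqxx -gn natrK.
move=> gge0 tau1; have gt0 : 0 < gamma by rewrite lt_neqAle eq_sym g0.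
case: tau1 => ->.
  apply: Or33; split=> //; apply/funext => t.
  by rewrite /spow (negPf g0) oppr_eq0 oner_eq0 lt_eqF//; lra.
apply: Or32; split=> //; apply/funext => t.
by rewrite /spow (negPf g0) oner_eq0 eqxx.
Qed.

(** The sign function is discontinuous at 0; the right-hand side is built from
    continuous, and Lipschitz, positive and negative parts. *)
Lemma signed_powRE gamma t : 0 < gamma ->
  `|t| `^ gamma * Num.sg t =
  `|Num.max t 0| `^ gamma - `|Num.max (- t) 0| `^ gamma.
Proof.
move=> g0; have z : `|0 : R| `^ gamma = 0 by rewrite normr0 powR0// gt_eqF.
case: (ltgtP t 0) => t0.
- by rewrite ltr0_sg// z max_l ?normrN ?mulrN1 ?sub0r//; lra.
- by rewrite gtr0_sg// (@max_r _ _ (- t)) ?z ?subr0 ?mulr1//; lra.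
- by rewrite t0 sgr0 oppr0 maxxx mulr0 subrr.
Qed.

Lemma spowM tau gamma t s : omega (gamma, tau) -> 0 < t ->
  spow tau gamma (t * s) = t `^ gamma * spow tau gamma s.
Proof.
move=> /spow_cases[[n -> ->]|[g0 ->]|[g0 ->]] t0.
- by rewrite exprMn powR_mulrn// ltW.
- by rewrite normrM powRM// gtr0_norm.
- by rewrite normrM powRM// gtr0_norm// sgrM gtr0_sg// mul1r mulrA.
Qed.

Lemma spow_continuous tau gamma : omega (gamma, tau) ->
  continuous (spow tau gamma).
Proof.
move=> /spow_cases[[n _ ->]|[g0 ->]|[g0 ->]].
- exact: exprn_continuous.
- exact/abs_powR_continuous/ltW.
have -> : (fun t => `|t| `^ gamma * Num.sg t) = (fun t =>
    `|Num.max t 0| `^ gamma - `|Num.max (- t) 0| `^ gamma).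
  by apply/funext => t; exact: signed_powRE.
have posp := loclip_continuous (@loclip_posp R).
have cg := abs_powR_continuous (ltW g0).
move=> t; apply: (@cvgB _ _ _ _ _ (fun t => `|Num.max t 0| `^ gamma)
  (fun t => `|Num.max (- t) 0| `^ gamma)).
  exact: (continuous_comp (posp t) (cg _)).
apply: (continuous_comp (f := fun s : R => - s)
   (g := fun s => `|Num.max s 0| `^ gamma)); first exact: opp_continuous.
exact: (continuous_comp (posp _) (cg _)).
Qed.

Lemma spow_loclip tau gamma : omega (gamma, tau) -> gamma = 0 \/ 1 <= gamma ->
  loclip (spow tau gamma).
Proof.
move=> /spow_cases[[n _ ->]|[g0 ->]|[g0 ->]] g1.
- elim: n => [|n IH]; first exact: loclip_cst.
  have -> : (fun t : R => t ^+ n.+1) = fun t => t * t ^+ n.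
    by apply/funext => t; rewrite exprS.
  exact: loclipM (@loclip_id _ _) IH.
- by apply: loclip_abs_powR; case: g1 => //; lra.
have {}g1 : 1 <= gamma by case: g1 => //; lra.
have -> : (fun t => `|t| `^ gamma * Num.sg t) = (fun t =>
    `|Num.max t 0| `^ gamma + - `|Num.max (- t) 0| `^ gamma).
  by apply/funext => t; exact: signed_powRE.
have lp := loclip_comp (@loclip_posp R) (loclip_abs_powR g1).
apply: loclipD; first exact: lp.
apply: loclip_comp (@loclip_opp _ _).
exact: (loclip_comp (@loclip_opp _ _) lp).
Qed.

End ScalarPower.

Section TypeMRegularity.
Context {R : realType} {d : nat}.
Implicit Types (T : typeM R d) (F : 'cV[R]_d -> 'cV[R]_d).

Lemma typeM_homogeneous T :
  homogeneous (abs_nu T + abs_gamma T) (typeM_fun T).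
Proof.
move=> x t t0; rewrite /typeM_fun scalerA; congr (_ *: _).
have -> : normpow (tp T) (tnu T) (t *: x) =
    t `^ abs_nu T * normpow (tp T) (tnu T) x.
  rewrite /abs_nu -prod_powR// /normpow -big_split/=; apply: eq_bigr => i _.
  by rewrite lqnormZ ?tp_ge1// powRM ?lqnorm_ge0// ltW.
have -> : spowv (ttau T) (tgamma T) (t *: x) =
    t `^ abs_gamma T * spowv (ttau T) (tgamma T) x.
  rewrite /abs_gamma -prod_powR// /spowv -big_split/=; apply: eq_bigr => j _.
  by rewrite mxE spowM//; exact: t_omega.
by rewrite mulrACA powRD// (gt_eqF t0) implybT.
Qed.

Lemma typeM_continuous T : continuous (typeM_fun T).
Proof.
have cp (n : nat) (f : 'I_n -> 'cV[R]_d -> R) : (forall i, continuous (f i)) ->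
    continuous (fun x => \prod_(i < n) f i x).
  by move=> cf; apply: continuous_big => //; exact: mul_continuous.
suff cc : continuous (fun x => normpow (tp T) (tnu T) x *
    spowv (ttau T) (tgamma T) x) by move=> x; exact: cvgZr_tmp (cc x).
move=> x; apply: (@continuousM _ _ (normpow (tp T) (tnu T))).
all: apply: cp => i {}x.
  have -> : (fun x : 'cV[R]_d => lqnorm (tp T i) x `^ tnu T i) =
      (fun s => `|s| `^ tnu T i) \o (fun x => lqnorm (tp T i) x).
    by apply/funext => y /=; rewrite ger0_norm ?lqnorm_ge0.
  have cl : continuous (lqnorm (tp T i) : 'cV[R]_d -> R) :=
    loclip_continuous (loclip_lqnorm (tp_ge1 T i)).
  have cg : continuous (fun s : R => `|s| `^ tnu T i) :=
    abs_powR_continuous (tnu_ge0 T i).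
  exact: (continuous_comp (cl x) (cg _)).
have cs : continuous (spow (ttau T i) (tgamma T i)) :=
  spow_continuous (t_omega T i).
have cc : continuous (fun x : 'cV[R]_d => x i 0) := @coord_continuous _ _ _ i 0.
exact: (continuous_comp (cc x) (cs _)).
Qed.

Lemma typeM_loclip T :
  abs_nu T = 0 \/ (forall i, 1 <= tnu T i) ->
  (forall j, tgamma T j = 0 \/ 1 <= tgamma T j) ->
  loclip (typeM_fun T).
Proof.
move=> nuT gT; apply: loclipZl; apply: loclipM; apply: loclip_prod => i.
  have [nu0|nu1] : tnu T i = 0 \/ 1 <= tnu T i.
  - case: nuT => [|nu1]; last by right.
    move=> /eqP; rewrite psumr_eq0 => [/allP/(_ i (mem_index_enum _))/eqP|k _].
      by left.
    exact: tnu_ge0.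
  - have -> : (fun x : 'cV[R]_d => lqnorm (tp T i) x `^ tnu T i) = fun=> 1.
      by apply/funext => y; rewrite nu0 powRr0.
    exact: loclip_cst.
  have -> : (fun x : 'cV[R]_d => lqnorm (tp T i) x `^ tnu T i) =
      (fun s => `|s| `^ tnu T i) \o (fun x => lqnorm (tp T i) x).
    by apply/funext => y /=; rewrite ger0_norm ?lqnorm_ge0.
  exact: loclip_comp (loclip_lqnorm (tp_ge1 T i)) (loclip_abs_powR nu1).
exact: (loclip_comp (loclip_coord i) (spow_loclip (t_omega T i) (gT i))).
Qed.

End TypeMRegularity.

(** * Smoothness away from the coordinate hyperplanes *)

Section Smoothness.
Context {R : realType} {d : nat}.
Implicit Types (f g : 'cV[R]_d -> R) (x v : 'cV[R]_d).

(** The functions whose smoothness on [Rstar] is established.  They are stable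
    under directional derivatives because real powers are allowed only for
    functions positive on [Rstar]: the derivative of such a power involves the
    power with exponent b - 1, which may be negative. *)
Inductive powalg : ('cV[R]_d -> R) -> Prop :=
| powalg_cst c : powalg (fun=> c)
| powalg_coord j : powalg (fun x => x j 0)
| powalg_abs j : powalg (fun x => `|x j 0|)
| powalg_sg j : powalg (fun x => Num.sg (x j 0))
| powalgD f g : powalg f -> powalg g -> powalg (fun x => f x + g x)
| powalgM f g : powalg f -> powalg g -> powalg (fun x => f x * g x)
| powalg_powR f b : powalg f -> (forall x, Rstar x -> 0 < f x) ->
    powalg (fun x => f x `^ b).

Lemma near_Rstar x : Rstar x -> \forall y \near x, Rstar y.
Proof.
move=> xV; apply: (@filter_forall _ _ (fun j => [set y : 'cV[R]_d | y j 0 != 0])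
  _ (nbhs_filter x)).
move=> j; have cj : {for x, continuous (fun y : 'cV[R]_d => y j 0)}.
  exact: coord_continuous.
exact: cj (open_nbhs_nbhs (conj (@open_neq R 0) (xV j))).
Qed.

Lemma is_diff_coord (j : 'I_d) x :
  is_diff x (fun y : 'cV[R]_d => y j 0) (fun v => v j 0).
Proof.
have lin : linear (fun y : 'cV[R]_d => y j 0 : R) by move=> a u v; rewrite !mxE.
pose f : {linear 'cV[R]_d -> R} := HB.pack (fun y : 'cV[R]_d => y j 0 : R)
  (GRing.isLinear.Build _ _ _ _ _ lin).
have cf : continuous f by exact: coord_continuous.
by split; [exact: (linear_differentiable x cf)|exact: (diff_lin x cf)].
Qed.

Lemma near_sg_coord (j : 'I_d) x : Rstar x ->
  \forall y \near x, Num.sg ((y : 'cV[R]_d) j 0) = Num.sg (x j 0).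
Proof.
move=> /(_ j) x0.
have : \forall y \near x, 0 < Num.sg (x j 0) * (y : 'cV[R]_d) j 0.
  have cf : {for x, continuous (fun y : 'cV[R]_d => Num.sg (x j 0) * y j 0)}.
    by apply: differentiable_continuous; apply: differentiableM => //;
      exact: differentiable_coord.
  apply: (cf _ (open_nbhs_nbhs (conj (@open_gt R 0) _))) => /=.
  by rewrite -normrEsg normr_gt0.
apply: filterS => y; rewrite -sgr_gt0 sgrM sgr_id.
by case: sgrP => // _; case: sgrP => // _;
  rewrite ?mulr1 ?mulrN1 ?mulN1r ?mul1r; lra.
Qed.

Lemma is_diff_sg (j : 'I_d) x : Rstar x ->
  is_diff x (fun y : 'cV[R]_d => Num.sg (y j 0)) (fun=> 0).
Proof.
move=> xV; apply: (@near_eq_is_diff _ _ _ (cst (Num.sg (x j 0)))).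
by apply: filterS (near_sg_coord j xV) => y ->.
Qed.

Lemma is_diff_abs (j : 'I_d) x : Rstar x ->
  is_diff x (fun y : 'cV[R]_d => `|y j 0|) (fun v => Num.sg (x j 0) * v j 0).
Proof.
move=> xV.
apply: (@near_eq_is_diff _ _ _ (Num.sg (x j 0) *: (fun y : 'cV[R]_d => y j 0))).
  by apply: filterS (near_sg_coord j xV) => y yx; rewrite normrEsg yx.
exact: is_diffZ (is_diff_coord j x).
Qed.

Lemma is_diff_powR f (df : 'cV[R]_d -> R) (b : R) x : 0 < f x ->
  is_diff x f df ->
  is_diff x (fun y => f y `^ b) (fun v => b * f x `^ (b - 1) * df v).
Proof.
move=> fx0 fdf; have [db eb] := is_derive1_powR b fx0.
have dp : differentiable (fun s : R => s `^ b) (f x) by exact/derivable1_diffP.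
split; first exact: (@differentiable_comp _ _ _ _ f (fun s : R => s `^ b)).
rewrite (@diff_comp _ _ _ _ f (fun s : R => s `^ b))//.
apply/funext => v /=; rewrite diff1E// derive1E eb diff_val.
by rewrite /GRing.scale/= mulrC.
Qed.

(** Stability under directional derivatives: the absolute value of a coordinate
    contributes its sign, the sign contributes 0, and the remaining cases are
    the sum, product and power rules. *)
Lemma powalg_diff f : powalg f ->
  (forall x, Rstar x -> differentiable f x) /\
  (forall v, exists2 g, powalg g & forall x, Rstar x -> 'd f x v = g x).
Proof.
elim=> {f} [c|j|j|j|f g _ [df Df] _ [dg Dg]|f g pf [df Df] pg [dg Dg]|
    f b pf [df Df] f0].
- split=> [x _|v]; first exact: differentiable_cst.
  by exists (fun=> 0); [exact: powalg_cst|move=> x _; rewrite diff_cst].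
- split=> [x _|v]; first exact: (@ex_diff _ _ _ _ _ _ _ (is_diff_coord j x)).
  exists (fun=> v j 0); first exact: powalg_cst.
  by move=> x _; rewrite (@diff_val _ _ _ _ _ _ _ (is_diff_coord j x)).
- split=> [x xV|v]; first exact: (@ex_diff _ _ _ _ _ _ _ (is_diff_abs j xV)).
  exists (fun x => Num.sg (x j 0) * v j 0).
    by apply: powalgM; [exact: powalg_sg|exact: powalg_cst].
  by move=> x xV; rewrite (@diff_val _ _ _ _ _ _ _ (is_diff_abs j xV)).
- split=> [x xV|v]; first exact: (@ex_diff _ _ _ _ _ _ _ (is_diff_sg j xV)).
  exists (fun=> 0); first exact: powalg_cst.
  by move=> x xV; rewrite (@diff_val _ _ _ _ _ _ _ (is_diff_sg j xV)).
- split=> [x xV|v]; first by apply: differentiableD; [exact: df|exact: dg].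
  have [f' pf' f'E] := Df v; have [g' pg' g'E] := Dg v.
  exists (fun x => f' x + g' x); first exact: powalgD.
  by move=> x xV; rewrite (diffD (df x xV) (dg x xV)) /= f'E// g'E.
- split=> [x xV|v]; first by apply: differentiableM; [exact: df|exact: dg].
  have [f' pf' f'E] := Df v; have [g' pg' g'E] := Dg v.
  exists (fun x => f x * g' x + g x * f' x).
    by apply: powalgD; exact: powalgM.
  by move=> x xV; rewrite (diffM (df x xV) (dg x xV)) -f'E// -g'E.
have D x (xV : Rstar x) :=
  is_diff_powR b (f0 x xV) (differentiableP (df x xV)).
split=> [x xV|v]; first exact: (@ex_diff _ _ _ _ _ _ _ (D x xV)).
have [f' pf' f'E] := Df v.
exists (fun x => b * f x `^ (b - 1) * f' x).
  apply: powalgM => //; apply: powalgM; first exact: powalg_cst.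
  exact: powalg_powR.
by move=> x xV; rewrite (@diff_val _ _ _ _ _ _ _ (D x xV)) f'E.
Qed.

(** Equality is assumed only on [Rstar] so that the induction goes through:
    outside of [Rstar] nothing relates the differential of F to the sum of the
    derivatives of the coefficients. *)
Lemma ndiff_powalg k n (a : 'I_n -> 'cV[R]_d -> R) (c : 'I_n -> 'cV[R]_d)
    (F : 'cV[R]_d -> 'cV[R]_d) :
  (forall i, powalg (a i)) ->
  (forall x, Rstar x -> F x = \sum_(i < n) a i x *: c i) ->
  ndiff k Rstar F.
Proof.
elim: k a F => //= k IH a F pa FE.
have da i x : Rstar x -> differentiable (fun y => a i y *: c i) x.
  move=> xV; apply: differentiableZl.
  by have [+ _] := powalg_diff (pa i); exact.
pose G : 'cV[R]_d -> 'cV[R]_d := \sum_(i < n) (fun y => a i y *: c i).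
have dG x : Rstar x -> is_diff x F ('d G x).
  move=> xV; apply: (@near_eq_is_diff _ _ _ G).
    apply: filterS (near_Rstar xV) => y yV.
    by rewrite FE// /G fct_sumE.
  by apply: differentiableP; apply: differentiable_sum => i; exact: da.
split=> [x /dG/@ex_diff//|v].
have /choice[g gP] i : exists g, powalg g /\
    forall x, Rstar x -> 'd (a i) x v = g x.
  by have [_ /(_ v)[g pg gE]] := powalg_diff (pa i); exists g.
apply: (IH g) => [i|x xV]; first by have [] := gP i.
have [_ ->] := dG x xV.
have dGx : differentiable G x by apply: differentiable_sum => i; exact: da.
rewrite -deriveE// /G derive_sum => [|i]; last exact/diff_derivable/da.
apply: eq_bigr => i _; rewrite deriveE; last exact: da.
have [dai _] := powalg_diff (pa i); have [_ gE] := gP i.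
by rewrite (diffZl _ (dai x xV)) gE.
Qed.

Lemma powalg_sum (I : Type) (s : seq I) (f : I -> 'cV[R]_d -> R) :
  (forall i, powalg (f i)) -> powalg (fun x => \sum_(i <- s) f i x).
Proof.
move=> pf; elim: s => [|i s IH].
  have -> : (fun x => \sum_(i <- [::]) f i x) = fun=> 0.
    by apply/funext => x; rewrite big_nil.
  exact: powalg_cst.
have -> : (fun x => \sum_(j <- i :: s) f j x) = fun x =>
    f i x + \sum_(j <- s) f j x.
  by apply/funext => x; rewrite big_cons.
exact: powalgD.
Qed.

Lemma powalg_prod (I : Type) (s : seq I) (f : I -> 'cV[R]_d -> R) :
  (forall i, powalg (f i)) -> powalg (fun x => \prod_(i <- s) f i x).
Proof.
move=> pf; elim: s => [|i s IH].
  have -> : (fun x => \prod_(i <- [::]) f i x) = fun=> 1.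
    by apply/funext => x; rewrite big_nil.
  exact: powalg_cst.
have -> : (fun x => \prod_(j <- i :: s) f j x) = fun x =>
    f i x * \prod_(j <- s) f j x.
  by apply/funext => x; rewrite big_cons.
exact: powalgM.
Qed.

Lemma powalg_abs_powR (j : 'I_d) (b : R) :
  powalg (fun x : 'cV[R]_d => `|x j 0| `^ b).
Proof.
apply: powalg_powR; first exact: powalg_abs.
by move=> x xV; rewrite normr_gt0.
Qed.

Lemma powalg_lqnorm (q b : R) : (0 < d)%N ->
  powalg (fun x : 'cV[R]_d => lqnorm q x `^ b).
Proof.
move=> d0; have S0 (x : 'cV[R]_d) : Rstar x -> 0 < \sum_(j < d) `|x j 0| `^ q.
  move=> xV; rewrite (bigD1 (Ordinal d0))//= ltr_wpDr ?sumr_ge0//.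
  by rewrite powR_gt0// normr_gt0.
apply: powalg_powR; last by move=> x /S0 x0; rewrite powR_gt0.
by apply: powalg_powR => //; apply: powalg_sum => j; exact: powalg_abs_powR.
Qed.

Lemma powalg_spow (tau gamma : R) (j : 'I_d) : omega (gamma, tau) ->
  powalg (fun x : 'cV[R]_d => spow tau gamma (x j 0)).
Proof.
move=> /spow_cases[[n _ ->]|[_ ->]|[_ ->]].
- elim: n => [|n IH]; first exact: powalg_cst.
  have -> : (fun x : 'cV[R]_d => x j 0 ^+ n.+1) = fun x => x j 0 * x j 0 ^+ n.
    by apply/funext => x; rewrite exprS.
  by apply: powalgM => //; exact: powalg_coord.
- exact: powalg_abs_powR.
- by apply: powalgM; [exact: powalg_abs_powR|exact: powalg_sg].
Qed.

Lemma powalg_typeM (T : typeM R d) : (0 < d)%N ->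
  powalg (fun x => normpow (tp T) (tnu T) x * spowv (ttau T) (tgamma T) x).
Proof.
move=> d0; apply: powalgM; apply: powalg_prod => i; first exact: powalg_lqnorm.
exact: powalg_spow (t_omega T i).
Qed.

End Smoothness.

(** * Expansions *)

Lemma homogeneous0 (R : realType) (d : nat) (beta : R)
    (F : 'cV[R]_d -> 'cV[R]_d) : 0 < beta -> homogeneous beta F -> F 0 = 0.
Proof.
move=> b0 /(_ 0 2 (ltr0Sn _ 1)) /esym/eqP.
rewrite scaler0 -subr_eq0 -{2}[F 0]scale1r -scalerBl scaler_eq0 subr_eq0.
rewrite powR_eq1 => /orP[p1|/eqP//]; exfalso.
by case/or3P: p1 => [/eqP||/eqP]; lra.
Qed.

Section Approximation.
Context {R : realType} {d : nat}.
Implicit Types (F G H : 'cV[R]_d -> 'cV[R]_d).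

Lemma loclip_locally_lipschitz F : loclip F -> locally_lipschitz F.
Proof.
move=> lF x; have [U xU [K FK]] := lF x; exists U => //.
have Ux := nbhs_singleton xU.
apply: (@klipschitzW _ _ _ K).
  by apply: (@globally_properfilter _ _ (x, x)).
by move=> [y z] /= [Uy Uz]; exact: FK.
Qed.

Lemma E2_exact V H N (beta : nat -> R) (F : nat -> 'cV[R]_d -> 'cV[R]_d) :
  (forall k, (k <= N)%N -> can_play_role V (beta k) (F k)) ->
  (forall k l, (k < l <= N)%N -> beta k < beta l) ->
  (forall x, H x = \sum_(k < N.+1) F k x) ->
  E2 V H.
Proof.
move=> roleF lt_beta HE; exists N, beta, F; split=> // beta' _.
exists 1, 1; split=> // x _; rewrite /remainder HE subrr mul1r.
rewrite (_ : enorm 0 = 0) ?powR_ge0//.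
by rewrite /enorm big1 ?sqrtr0// => j _; rewrite mxE expr0n.
Qed.

Lemma can_play_role_sum n (T : 'I_n -> typeM R d) (P : pred 'I_n) (beta : R) :
  (0 < d)%N -> 1 < beta ->
  (forall k, P k -> abs_nu (T k) + abs_gamma (T k) = beta) ->
  can_play_role Rstar beta (fun x => \sum_(k < n | P k) typeM_fun (T k) x).
Proof.
move=> d0 beta1 degT; split=> // [x t t0|m].
  rewrite scaler_sumr; apply: eq_bigr => k Pk.
  by rewrite (typeM_homogeneous (T k))// degT.
apply: (@ndiff_powalg _ _ _ n (fun k x =>
    normpow (tp (T k)) (tnu (T k)) x * spowv (ttau (T k)) (tgamma (T k)) x)
  (fun k => if P k then tc (T k) else 0)) => [k|x _].
  exact: powalg_typeM.
rewrite big_mkcond; apply: eq_bigr => k _.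
by case: (P k); rewrite ?scaler0.
Qed.

(** The expansion of H has one term for each degree occurring among the T k, the
    sum of all the T k of that degree. *)
Lemma E2_sum_typeM n (T : 'I_n -> typeM R d) H :
  (0 < d)%N ->
  (forall k, 1 < abs_nu (T k) + abs_gamma (T k)) ->
  (forall x, H x = \sum_(k < n) typeM_fun (T k) x) ->
  E2 Rstar H.
Proof.
move=> d0 deg1 HE; pose deg k := abs_nu (T k) + abs_gamma (T k).
(* the extra degree 2 keeps the list nonempty when n = 0; its group may be
   empty and then contributes the zero function *)
pose s := sort <=%O (undup (2 :: map deg (enum 'I_n))).
have mem_s z : (z \in s) = (z \in 2 :: map deg (enum 'I_n)).
  by rewrite mem_sort mem_undup.
have deg_s k : deg k \in s.
  by rewrite mem_s in_cons map_f ?orbT// mem_enum.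
have s_gt0 : (0 < size s)%N.
  apply: (@leq_ltn_trans (index 2 s)); first exact: leq0n.
  by rewrite index_mem mem_s mem_head.
have s_gt1 k : (k <= (size s).-1)%N -> 1 < nth 0 s k.
  rewrite -ltnS prednK// => ks; have := mem_nth 0 ks.
  rewrite mem_s in_cons => /predU1P[->|/mapP[j _ ->]]; [lra|exact: deg1].
have s_sorted : sorted <%O s by rewrite sort_lt_sorted undup_uniq.
apply: (@E2_exact _ _ (size s).-1 (nth 0 s) (fun k x =>
  \sum_(j < n | index (deg j) s == k) typeM_fun (T j) x)).
- move=> k ks; apply: can_play_role_sum => //; first exact: s_gt1.
  by move=> j /eqP <-; rewrite nth_index.
- move=> k l /andP[kl]; rewrite -ltnS prednK// => ls.
  by rewrite (lt_sorted_ltn_nth 0 s_sorted)// inE// (ltn_trans kl).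
move=> x; rewrite HE prednK//.
have idx k : (index (deg k) s < size s)%N by rewrite index_mem.
by rewrite (partition_big (fun k => Ordinal (idx k)) xpredT).
Qed.

End Approximation.

Theorem theorem6p9 (R : realType) (d : nat) (hd : (0 < d)%N) (A : 'M[R]_d)
    (A_diag : diagonalizable A)
    (A_pos : forall a : R, eigenvalue A a -> 0 < a)
    (A_eigen : forall v : 'cV[R]_d, eigenvector A v -> Rstar v) :
  (forall (F : 'cV[R]_d -> 'cV[R]_d) (beta : R), 1 < beta ->
     sum_typeM (fun T : typeM R d => abs_nu T + abs_gamma T = beta) F ->
     (F 0 = 0 /\ homogeneous beta F /\ continuous F /\ smooth Rstar F) /\
     (classX0 Rstar F /\ can_play_role Rstar beta F)) /\
  (forall F : 'cV[R]_d -> 'cV[R]_d,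
     sum_typeM (fun T : typeM R d =>
       [/\ 1 < abs_nu T + abs_gamma T,
           abs_nu T = 0 \/ (forall i, 1 <= tnu T i) &
           forall j, tgamma T j = 0 \/ 1 <= tgamma T j]) F ->
     classX Rstar F).
Proof.
split=> [F beta beta1 [n [T [degT FE]]]|F [n [T [condT FE]]]].
  have FS : F = fun x => \sum_(k < n) typeM_fun (T k) x by exact/funext.
  have role : can_play_role Rstar beta F.
    by rewrite FS; apply: can_play_role_sum => // k _; exact: degT.
  have cF : continuous F.
    rewrite FS; apply: continuous_big => [|k _]; first exact: add_continuous.
    exact: typeM_continuous.
  have [_ homF smoothF] := role.
  split; first by split=> //; apply: homogeneous0 homF; lra.
  split=> //; split=> //; right; apply: E2_sum_typeM FE => // k.
  by rewrite degT.
split; last by right; apply: E2_sum_typeM FE => // k; have [] := condT k.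
apply: loclip_locally_lipschitz.
have -> : F = fun x => \sum_(k < n) typeM_fun (T k) x by exact/funext.
by apply: loclip_sum => k; have [_ nuT gT] := condT k; exact: typeM_loclip.
Qed.
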